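(* Let $(\hat x,\hat y)\in C\times Y$, and for $\lambda\ge0$ consider the regularized problem $$\min\ \phi^{\rho}(x)+\lambda\Bigl[\tfrac12\|x-\hat x\|_X^2+\tfrac12\|w-\hat y\|_Y^2\Bigr]\quad\text{over }w\in Y,\ x\in C\quad\text{subject to }c(x)+\lambda w=0.\qquad(\mathrm{P}_\lambda)$$ For $\lambda>0$ write $\Delta t=1/\lambda$. Then for $\lambda>0$ the problem $(\mathrm{P}_\lambda)$ has the following properties: 1. It satisfies the following strong constraint qualification: with constraint function $\tilde c(w,x)=c(x)+\lambda w$ on $Y\times X$, there exists a continuously Fréchet differentiable mapping $S:C\to Y$ such that for all $(w,x)\in Y\times C$: (a) $\tilde c(w,x)=0$ if and only if $w=S(x)$; (b) the range of the partial derivative $\tilde c'_w(w,x)$ is $Y$; (c) the range of its adjoint $\nabla_w\tilde c(w,x)$ is $Y$. 2. Its primal-dual solutions $(\bar w,\bar x,\bar y)\in Y\times C\times Y$ satisfy $\bar w=-\Delta t\,c(\bar x)$ and the projected backward Euler equations $$\bar x-P_C\bigl(\hat x-\Delta t\,\nabla_xL^{\rho}(\bar x,\bar y)\bigr)=0,\qquad\bar y-\hat y-\Delta t\,c(\bar x)=0 .$$ 3. Provided that $\nabla L^{\rho}$ is globally Lipschitz continuous, for $\lambda\to\infty$, i.e. $\Delta t\to0$, its unique primal-dual solution $(\bar w,\bar x,\bar y)$ (existing uniquely for all sufficiently large $\lambda$) tends to $(0,\hat x,\hat y)$. For $\lambda=0$, i.e. $\Delta t=\infty$, the primal-dual solutions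 of $(\mathrm{P}_0)$ are given by arbitrary $\bar w\in Y$ together with $\bar x$ and $\bar y$ that coincide with the primal-dual solutions of the problem $\min\phi(x)$ over $x\in C$ subject to $c(x)=0$.
   Context: Setting and standing assumptions: $X,Y$ are real Hilbert spaces, $C\subseteq X$ is nonempty, closed and convex, $\phi:X\to\mathbb{R}$ and $c:X\to Y$ are twice continuously Fréchet differentiable, $\mathcal{F}=\{x\in C\mid c(x)=0\}$. Gradients are Riesz representatives; $\nabla c(x)=(c'(x))^{\star}\in\mathcal{L}(Y,X)$ is the Hilbert space adjoint of $c'(x)$. For a fixed $\rho\in\mathbb{R}_{\ge0}$, $\phi^{\rho}(x)=\phi(x)+\frac{\rho}{2}\|c(x)\|_Y^2$ and $L^{\rho}(x,y)=\phi^{\rho}(x)+(y,c(x))_Y$, so $\nabla_xL^{\rho}(x,y)=\nabla\phi(x)+\nabla c(x)[y+\rho c(x)]$, $\nabla_yL^{\rho}(x,y)=c(x)$, and $\nabla L^{\rho}=(\nabla_xL^{\rho},\nabla_yL^{\rho})$. It is assumed throughout that: the range of $c'(x)$ is closed in $Y$ for all $x\in\mathcal{F}$; $\inf_{x\in C}\phi^{\rho}(x)>-\infty$ and $\phi^{\rho}(x)\to\infty$ as $\|x\|_X\to\infty$; $c$, $L^{\rho}$ and $\nabla L^{\rho}$ are locally Lipschitz continuous. $P_C$ is the metric projection onto $C$. Tangent cone: $T(M,\bar x)=\{d\in X\mid$ there exist $(x_k)\subset M$, $(\lambda_k)\subset\mathbb{R}_{\ge0}$ with $x_k\to\bar x$,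 $\lambda_k(x_k-\bar x)\to d\}$; $T^-(M,\bar x)=\{d\in X\mid(d,v)_X\le0\ \forall v\in T(M,\bar x)\}$. A primal-dual solution of a problem $\min f(z)$ over $z\in D$ subject to $g(z)=0$ ($D$ a closed convex subset of a Hilbert space $Z$, $g:Z\to Y$) is a pair $(\bar z,\bar y)$ in which $\bar z$ is a local minimizer and $\bar y\in Y$ is a Lagrange multiplier, i.e. $-\nabla f(\bar z)-\nabla g(\bar z)\bar y\in T^-(D,\bar z)$. For $(\mathrm{P}_\lambda)$ this is applied with $z=(w,x)$, $Z=Y\times X$, $D=Y\times C$, $g(w,x)=c(x)+\lambda w$. *)

(* Defs.v *)
From HB Require Import structures.
From mathcomp Require Export all_boot all_order all_algebra.
From mathcomp Require Export all_classical all_reals all_analysis.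
Export Order.TTheory GRing.Theory Num.Theory.
Export numFieldNormedType.Exports.

Set Implicit Arguments.
Unset Strict Implicit.
Unset Printing Implicit Defensive.

Local Open Scope classical_set_scope.
Local Open Scope ring_scope.

HB.mixin Record CompleteNormedModule_isHilbert (R : realType) V
    of CompleteNormedModule R V := {
  inner : {dot V for (@idfun R)} ;
  inner_norm : forall x : V, inner x x = `|x| ^+ 2
}.

#[short(type="hilbertType")]
HB.structure Definition Hilbert (R : realType) :=
  {V of CompleteNormedModule R V & CompleteNormedModule_isHilbert R V}.

Arguments inner {R s}.

(* The library norms a product space by the maximum of the two norms.  The
   Hilbert space structure of V * W is therefore carried by [pair_inner], whose
   norm is equivalent to the maximum norm: topology, Frechet derivatives and
   Lipschitz continuity are the same for both.  For this reason the notions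
   below that are used on product spaces take the inner product as an argument. *)
Definition pair_inner (R : realType) (V W : lmodType R)
    (ipV : V -> V -> R) (ipW : W -> W -> R) (p q : V * W) : R :=
  ipV p.1 q.1 + ipW p.2 q.2.

Section Gradients.
Context {R : realType} {V W : normedModType R}.

(* Riesz representative of the derivative of f at x. *)
Definition gradient (ipV : V -> V -> R) (f : V -> R) (x : V) : V :=
  xget 0 [set v | forall h, ipV v h = 'd f x h].

Definition adjoint (ipV : V -> V -> R) (ipW : W -> W -> R) (A : V -> W)
    (y : W) : V :=
  xget 0 [set v | forall h, ipV v h = ipW y (A h)].

End Gradients.

Section Smoothness.
Context {R : realType} {V W : normedModType R}.

(* For open U; the second clause is continuity of the derivative from U to
   the bounded linear maps with the operator norm. *)
Definition continuously_differentiable_on (U : set V) (f : V -> W) : Prop :=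
  (forall x, U x -> differentiable f x) /\
  (forall x, U x -> forall e : R, 0 < e ->
    \forall x' \near x, forall h, `|'d f x' h - 'd f x h| <= e * `|h|).

(* A map on an arbitrary set C is continuously differentiable when it extends
   to a continuously differentiable map on an open neighbourhood of C. *)
Definition continuously_differentiable_from (C : set V) (f : V -> W) : Prop :=
  exists (U : set V) (F : V -> W),
    [/\ open U, C `<=` U, {in C, F =1 f} & continuously_differentiable_on U F].

(* The second derivative, an element of L(V, L(V, W)), is represented by the
   bounded bilinear map f2 x; the norm of L(V, L(V, W)) becomes the best
   constant in |B h k| <= e |h| |k|. *)
Definition twice_continuously_differentiable (f : V -> W) : Prop :=
  (forall x, differentiable f x) /\
  exists f2 : V -> {bilinear V -> V -> W},
    [/\ forall x, exists M : R, forall h k, `|f2 x h k| <= M * `|h| * `|k|,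
        forall x (e : R), 0 < e -> \forall h \near (0 : V), forall k,
          `|'d f (x + h) k - 'd f x k - f2 x h k| <= e * `|h| * `|k|
      & forall x (e : R), 0 < e -> \forall x' \near x, forall h k,
          `|f2 x' h k - f2 x h k| <= e * `|h| * `|k|].

End Smoothness.

(* Neighbourhoods of (x, x) in V * V are generated by the squares U * U. *)
Definition locally_lipschitz (R : realType) (V W : normedModType R)
    (f : V -> W) : Prop :=
  forall x : V, lipschitz_on f (nbhs (x, x)).

Definition tangent_cone (R : realType) (V : normedModType R) (M : set V)
    (x : V) : set V :=
  [set d | exists (xs : nat -> V) (ls : nat -> R),
    [/\ forall k, M (xs k), forall k, 0 <= ls k,
        xs k @[k --> \oo] --> x
      & ls k *: (xs k - x) @[k --> \oo] --> d]].

Definition polar_tangent_cone (R : realType) (V : normedModType R)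
    (ipV : V -> V -> R) (M : set V) (x : V) : set V :=
  [set d | forall v, tangent_cone M x v -> ipV d v <= 0].

Definition metric_projection (R : realType) (V : normedModType R) (C : set V)
    (x : V) : V :=
  xget 0 [set p | C p /\ forall q, C q -> `|x - p| <= `|x - q|].

Section ConstrainedProblem.
Context {R : realType} {V W : normedModType R}.
Variables (ipV : V -> V -> R) (ipW : W -> W -> R).
Variables (f : V -> R) (D : set V) (g : V -> W).

Definition local_minimizer (z : V) : Prop :=
  [/\ D z, g z = 0 &
      \forall z' \near z, D z' -> g z' = 0 -> f z <= f z'].

Definition primal_dual_solution (z : V) (y : W) : Prop :=
  local_minimizer z /\
  polar_tangent_cone ipV D z
    (- gradient ipV f z - adjoint ipV ipW ('d g z) y).

End ConstrainedProblem.

Section AugmentedLagrangian.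
Context {R : realType} {X Y : hilbertType R}.
Variables (phi : X -> R) (c : X -> Y) (rho : R).

Definition penalized (x : X) : R := phi x + rho / 2 * `|c x| ^+ 2.

Definition lagrangian (p : X * Y) : R := penalized p.1 + inner p.2 (c p.1).

Definition grad_x (x : X) (y : Y) : X :=
  gradient inner (fun x' => lagrangian (x', y)) x.

Definition grad_y (x : X) (y : Y) : Y :=
  gradient inner (fun y' => lagrangian (x, y')) y.

Definition grad_lagrangian (p : X * Y) : X * Y :=
  (grad_x p.1 p.2, grad_y p.1 p.2).

End AugmentedLagrangian.

Section RegularizedProblem.
Context {R : realType} {X Y : hilbertType R}.
Variables (C : set X) (phi : X -> R) (c : X -> Y) (rho : R).
Variables (xh : X) (yh : Y) (lambda : R).

Definition reg_objective (z : Y * X) : R :=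
  penalized phi c rho z.2 +
  lambda * (2^-1 * `|z.2 - xh| ^+ 2 + 2^-1 * `|z.1 - yh| ^+ 2).

Definition reg_constraint (z : Y * X) : Y := c z.2 + lambda *: z.1.

Definition reg_solution (z : Y * X) (y : Y) : Prop :=
  primal_dual_solution (pair_inner inner inner) inner
    reg_objective (setT `*` C) reg_constraint z y.

End RegularizedProblem.

Definition strong_constraint_qualification (R : realType) (X Y : hilbertType R)
    (C : set X) (ct : Y * X -> Y) : Prop :=
  exists S : X -> Y, continuously_differentiable_from C S /\
    forall (w : Y) (x : X), C x ->
      [/\ ct (w, x) = 0 <-> w = S x,
          range ('d (fun w' => ct (w', x)) w) = setT
        & range (adjoint inner inner ('d (fun w' => ct (w', x)) w)) = setT].

(* Main.v *)
From HB Require Import structures.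
Require Import Defs.
From mathcomp Require Import ring lra.

(* Eliminating w through w = - (c x) / lambda turns (P_lambda) into the
   minimization over C of
     L(x, yh) + |c x|^2 / (2 lambda) + lambda/2 |x - xh|^2 + constant.
   The first-order conditions, rewritten through the variational
   characterization of the metric projection, are the projected backward Euler
   equations: x is a fixed point of the map
     x |-> P_C (xh - dt * grad_x L (x, yh + dt * c x)),   dt = 1 / lambda.
   When the gradient of L has Lipschitz constant M and dt * M <= 1/2, this map
   is a 1/2-contraction, and the term lambda/2 |x - xh|^2 dominates the
   nonconvexity of the rest, so that its unique fixed point is a global
   minimizer.  The Lipschitz bound also gives
   |(w, x, y) - (0, xh, yh)| = O(dt). *)

Set Implicit Arguments.
Unset Strict Implicit.
Unset Printing Implicit Defensive.

Local Open Scope classical_set_scope.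
Local Open Scope ring_scope.

(** * Inner product identities and the Cauchy-Schwarz inequality *)

Section InnerProduct.
Context {R : realType} {X : hilbertType R}.
Implicit Types (x y z : X) (k : R).

Lemma innerC x y : inner x y = inner y x.
Proof. by rewrite hermC/= expr0 mul1r. Qed.

Lemma innerDl x y z : inner (x + y) z = inner x z + inner y z.
Proof. exact: linearDl. Qed.

Lemma innerNl x z : inner (- x) z = - inner x z.
Proof. exact: linearNl. Qed.

Lemma innerZl k x z : inner (k *: x) z = k * inner x z.
Proof. exact: linearZl_LR. Qed.

Lemma innerDr x y z : inner x (y + z) = inner x y + inner x z.
Proof. exact: linearDr. Qed.

Lemma innerNr x z : inner x (- z) = - inner x z.
Proof. exact: linearNr. Qed.

Lemma innerZr k x z : inner x (k *: z) = k * inner x z.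
Proof. by rewrite innerC innerZl innerC. Qed.

Lemma inner0l x : inner 0 x = 0.
Proof. exact: linear0l. Qed.

Lemma inner0r x : inner x 0 = 0.
Proof. exact: linear0r. Qed.

Definition innerE := (innerDl, innerNl, innerZl, innerDr, innerNr, innerZr).


Lemma normB_sqr x y : `|x - y| ^+ 2 = `|x| ^+ 2 - 2 * inner x y + `|y| ^+ 2.
Proof. by rewrite -!inner_norm !innerE [inner y x]innerC; ring. Qed.

Lemma normD_sqr x y : `|x + y| ^+ 2 = `|x| ^+ 2 + 2 * inner x y + `|y| ^+ 2.
Proof. by rewrite -!inner_norm !innerE [inner y x]innerC; ring. Qed.

Lemma inner_ext x y : (forall h, inner x h = inner y h) -> x = y.
Proof.
move=> xy; apply/eqP; rewrite -subr_eq0 -normr_eq0 -sqrf_eq0 -inner_norm.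
by rewrite innerDl innerNl xy subrr.
Qed.

Lemma cauchy_schwarz x y : `|inner x y| <= `|x| * `|y|.
Proof.
have [->|y0] := eqVneq y 0; first by rewrite inner0r !normr0 mulr0.
have y2 : 0 < `|y| ^+ 2 by rewrite exprn_gt0// normr_gt0.
rewrite -ler_sqr ?nnegrE ?mulr_ge0// -normrX ger0_norm ?sqr_ge0// exprMn.
(* After multiplication by [|y| ^+ 2] the difference is a squared norm, namely of a multiple of the
   component of [x] orthogonal to [y]. *)
rewrite -subr_ge0 -(pmulr_rge0 _ y2).
suff -> : `|y| ^+ 2 * (`|x| ^+ 2 * `|y| ^+ 2 - inner x y ^+ 2) =
    `| `|y| ^+ 2 *: x - inner x y *: y | ^+ 2 by rewrite sqr_ge0.
by rewrite -!inner_norm !innerE [inner y x]innerC; ring.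
Qed.

Lemma inner_continuous_r x : continuous (inner x : X -> R).
Proof.
apply: (@bounded_linear_continuous _ _ _ (inner x)).
apply/linear_boundedP; near=> M => y.
by apply: (le_trans (cauchy_schwarz x y)); apply: ler_wpM2r.
Unshelve. all: by end_near. Qed.

End InnerProduct.

(** * Projection onto closed convex sets and Riesz representation *)

Lemma convex_set_segment (R : realType) (V : lmodType R) (C : set V) (x y : V)
    (t : R) : convex_set (C : set (convex_lmodType V)) -> C x -> C y ->
  0 <= t <= 1 -> C (x + t *: (y - x)).
Proof.
move=> cC Cx Cy /andP[t0 t1].
have -> : x + t *: (y - x) = t *: y + (1 - t) *: x.
  by rewrite scalerBl scalerBr scale1r addrCA.
by have := cC y x (Itv01 t0 t1); rewrite !inE; apply.
Qed.

Section MetricProjection.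
Context {R : realType} {X : hilbertType R}.
Variable C : set X.
Hypothesis C_convex : convex_set (C : set (convex_lmodType X)).

(** A minimizing sequence is Cauchy because midpoints of its terms stay in [C]; completeness of [X]
    and closedness of [C] then provide the minimizer. *)
Lemma nearest_point_exists (x : X) : closed C -> C !=set0 ->
  exists2 p, C p & forall q, C q -> `|x - p| <= `|x - q|.
Proof.
move=> C_closed [q0 Cq0].
pose S := [set `|x - q| ^+ 2 | q in C]; pose D := inf S.
have infS : has_inf S.
  split; first by exists (`|x - q0| ^+ 2); exists q0.
  by exists 0 => _ [q _ <-]; rewrite sqr_ge0.
have D_le q : C q -> D <= `|x - q| ^+ 2.
  by move=> Cq; apply: inf_lbound; [exact: infS.2|exists q].
have /choice[u uP] (n : nat) : exists q, C q /\ `|x - q| ^+ 2 < D + n.+1%:R^-1.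
  have [_ [q Cq <-] qD] := @inf_adherent _ S n.+1%:R^-1 ltac:(by []) infS.
  by exists q.
have half01 : 0 <= (2^-1 : R) <= 1.
  by rewrite invr_ge0 ler0n/= invf_le1// ler1n.
have u_dist n m : `|u n - u m| ^+ 2 <= 2 * (n.+1%:R^-1 + m.+1%:R^-1).
  have [[Cn un] [Cm um]] := (uP n, uP m).
  (* Parallelogram identity at the midpoint of [u n] and [u m]. *)
  have := D_le _ (convex_set_segment C_convex Cn Cm half01).
  have -> : `|x - (u n + 2^-1 *: (u m - u n))| ^+ 2 =
     2^-1 * `|x - u n| ^+ 2 + 2^-1 * `|x - u m| ^+ 2 -
     4^-1 * `|u n - u m| ^+ 2.
    rewrite -!inner_norm !innerE ![inner (u _) x]innerC.
    by rewrite [inner (u m) (u n)]innerC; field.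
  by move: un um; move: (n.+1%:R^-1) (m.+1%:R^-1) => a b ? ? ?; lra.
have cvgu : cvgn u.
  apply/cauchy_cvgP/cauchy_ballP => e e0; near_simpl.
  have e4 : 0 < e ^+ 2 / 4 by rewrite divr_gt0// exprn_gt0.
  near=> n m; rewrite -ball_normE /= -ltr_sqr ?nnegrE ?(ltW e0)//.
  apply: (le_lt_trans (u_dist n m)).
  have : n.+1%:R^-1 < e ^+ 2 / 4.
    by near: n; exact: near_infty_natSinv_lt (PosNum e4).
  have : m.+1%:R^-1 < e ^+ 2 / 4.
    by near: m; exact: near_infty_natSinv_lt (PosNum e4).
  by move: (n.+1%:R^-1) (m.+1%:R^-1) => a b ? ?; lra.
have Cp : C (limn u).
  apply: closed_cvg C_closed _ _ cvgu; apply: nearW => n; exact: (uP n).1.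
exists (limn u) => // q Cq.
rewrite -ler_sqr ?nnegrE//; apply: le_trans (D_le q Cq).
have cD : D + n.+1%:R^-1 @[n --> \oo] --> D.
  rewrite -[X in _ --> X]addr0.
  by apply: cvgD; [exact: cvg_cst|exact: cvg_harmonic].
have cu : `|x - u n| ^+ 2 @[n --> \oo] --> `|x - limn u| ^+ 2.
  have cn : `|x - u n| @[n --> \oo] --> `|x - limn u|.
    by apply: cvg_norm; apply: cvgB => //; exact: cvg_cst.
  by rewrite expr2; under eq_fun do rewrite expr2; exact: cvgM.
apply: ler_cvg_to cu cD _; apply: nearW => n; have [_ /ltW] := uP n; exact.
Unshelve. all: by end_near. Qed.

(** [metric_projection] is defined by choice, so [p] has to be the only minimizer. Minimality and
    uniqueness both follow from expanding [|x - q| ^+ 2] around [p]. *)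
Lemma metric_projection_unique (x p : X) : C p ->
  (forall q, C q -> inner (x - p) (q - p) <= 0) -> metric_projection C x = p.
Proof.
move=> Cp xp; rewrite /metric_projection.
have expand q : `|x - q| ^+ 2 =
    `|x - p| ^+ 2 - 2 * inner (x - p) (q - p) + `|q - p| ^+ 2.
  by rewrite -normB_sqr opprB addrA subrK.
apply: xget_unique.
  split => // q Cq; rewrite -ler_sqr ?nnegrE// (expand q).
  by have := xp _ Cq; have := sqr_ge0 `|q - p|; lra.
move=> q [Cq /(_ _ Cp)]; rewrite -ler_sqr ?nnegrE// (expand q) => le.
apply/eqP; rewrite -subr_eq0 -normr_eq0 -sqrf_eq0 eq_le sqr_ge0 andbT.
by have := xp _ Cq; lra.
Qed.

Lemma metric_projectionP (x : X) : closed C -> C !=set0 ->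
  C (metric_projection C x) /\
  forall q, C q ->
    inner (x - metric_projection C x) (q - metric_projection C x) <= 0.
Proof.
move=> clC C0; have [p Cp pmin] := nearest_point_exists x clC C0.
suff pvar q : C q -> inner (x - p) (q - p) <= 0.
  by rewrite (metric_projection_unique Cp).
move=> Cq; rewrite leNgt; apply/negP => gt0.
set a := inner (x - p) (q - p) in gt0; pose b := `|q - p| ^+ 2.
have b0 : 0 <= b by rewrite sqr_ge0.
(* Moving from [p] to parameter [t] on the segment lowers the squared distance by
   [t * (2 * a - t * b)]. This [t] lies in [0, 1] and satisfies [t * b < a], so the decrease is
   strict. *)
pose t := a / (a + b).
have ab : 0 < a + b by lra.
have t01 : 0 <= t <= 1.
  rewrite /t divr_ge0 ?(ltW gt0) ?(ltW ab)//=.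
  by rewrite ler_pdivrMr// mul1r lerDl.
have := pmin _ (convex_set_segment C_convex Cp Cq t01).
rewrite -ler_sqr ?nnegrE// opprD addrA (normB_sqr (x - p)) innerZr normrZ exprMn.
rewrite -normrX ger0_norm ?sqr_ge0// -/a -/b.
have t0 : 0 < t by rewrite divr_gt0.
have tab : t * (a + b) = a by rewrite /t divfK// gt_eqF.
suff : 0 < t * (2 * a - t * b) by lra.
by rewrite mulr_gt0//; have := mulr_gt0 t0 gt0; lra.
Qed.

(** With [p], [q] the two projections, adding their variational inequalities bounds [|p - q| ^+ 2]
    by [inner (x - y) (p - q)]; Cauchy-Schwarz concludes. *)
Lemma metric_projection_nonexpansive (x y : X) : closed C -> C !=set0 ->
  `|metric_projection C x - metric_projection C y| <= `|x - y|.
Proof.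
move=> clC C0.
have [Cp xp] := metric_projectionP x clC C0.
have [Cq yq] := metric_projectionP y clC C0.
move: (metric_projection C x) (metric_projection C y) Cp xp Cq yq.
move=> p q Cp xp Cq yq.
have := xp _ Cq; have := yq _ Cp => yqp xpq.
have key : `|p - q| ^+ 2 <= inner (x - y) (p - q).
  move: yqp xpq; rewrite -inner_norm !innerE => ? ?; lra.
have := le_trans key (le_trans (ler_norm _) (cauchy_schwarz _ _)).
have [->|pq] := eqVneq p q; first by rewrite subrr normr0.
by rewrite expr2 ler_pM2r// normr_gt0 subr_eq0.
Qed.

Lemma metric_projection_id (x : X) : C x -> metric_projection C x = x.
Proof.
by move=> Cx; apply: metric_projection_unique => // q _; rewrite subrr inner0l.
Qed.

End MetricProjection.

(** For nonzero [l], projecting a point outside the kernel onto the kernel leaves a residual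
    orthogonal to it; a multiple of that residual represents [l]. *)
Lemma riesz_representation (R : realType) (X : hilbertType R)
    (l : {linear X -> R}) : continuous l -> exists v, forall h, inner v h = l h.
Proof.
move=> l_cont; have [l0|/existsNP[x /eqP lx]] := pselect (forall x, l x = 0).
  by exists 0 => h; rewrite inner0l l0.
have lZ k y : l (k *: y) = k * l y by rewrite linearZ.
pose K := [set y | l y = 0].
have clK : closed K.
  apply: (closed_comp (f := l) (D := [set 0])); last exact: closed_eq.
  by move=> y _; exact: l_cont.
have cK : convex_set (K : set (convex_lmodType X)).
  move=> y z t; rewrite !inE /K/= => y0 z0.
  rewrite -[conv _ _ _]/(t%:num *: y + (1 - t%:num) *: z).
  by rewrite linearD !lZ y0 z0 !mulr0 addr0.
have K0 : K !=set0 by exists 0; rewrite /K/= linear0.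
have [Kp xp] := metric_projectionP cK x clK K0.
move: (metric_projection K x) Kp xp => p Kp xp.
have lp : l p = 0 := Kp.
(* z spans the orthogonal complement of the kernel. *)
pose z := x - p.
have zK h : K h -> inner z h = 0.
  move=> Kh; apply/eqP; rewrite eq_le; apply/andP; split.
    have := xp (h + p); rewrite addrK; apply.
    by rewrite /K/= linearD Kh lp addr0.
  rewrite -oppr_le0 -innerNr.
  have := xp (- h + p); rewrite addrK; apply.
  by rewrite /K/= linearD linearN/= Kh lp oppr0 addr0.
have lz : l z = l x by rewrite linearB/= lp subr0.
have z2 : inner z z != 0.
  rewrite inner_norm sqrf_eq0 normr_eq0; apply: contra_neq lx => z0.
  by rewrite -lz z0 linear0.
exists ((l z / inner z z) *: z) => h.
(* The vector [h - (l h / l z) *: z] is in the kernel; expanding its orthogonality to [z] gives the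
   value of [inner z h]. *)
have : inner z (h - (l h / l z) *: z) = 0.
  by apply: zK; rewrite /K/= linearB/= lZ divfK ?subrr// lz.
have lz0 : l z != 0 by rewrite lz.
rewrite innerDr innerNr !innerZr innerZl => /subr0_eq ->.
by field; apply/andP; split.
Qed.

(** * Rules for Frechet differentials *)

Section Differentials.
Context {R : realType} {V W : normedModType R}.

Lemma is_diff_quadratic (f : V -> W) (x : V) (A : {linear V -> W}) (K : R) :
  continuous A -> (forall h, `|f (x + h) - f x - A h| <= K * `|h| ^+ 2) ->
  is_diff x f A.
Proof.
move=> cA fA.
have expansion : f \o shift x = cst (f x) + A +o_ 0 id.
  have bound h : `|(f \o shift x - (cst (f x) + A)) h| <= K * `|h| * `|h|.
    rewrite -[_ h]/(f (h + x) - (f x + A h)) opprD addrA [h + x]addrC.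
    by rewrite -mulrA -expr2.
  (* [K] may have any sign: for [K <= 0] the bound holds at once, otherwise [|h| <= e / K] is
     imposed. *)
  apply/eqaddoP => e e0; have [K0|K0] := leP K 0.
    near=> h; apply: le_trans (bound h) _; rewrite ler_wpM2r//.
    by apply: le_trans (ltW e0); rewrite mulr_le0_ge0.
  have eK : 0 < e / K by rewrite divr_gt0.
  near=> h; apply: le_trans (bound h) _; rewrite ler_wpM2r//.
  by rewrite mulrC -ler_pdivlMr//; near: h; exact: nbhs0_le.
have dA := diff_unique cA expansion.
by apply: DiffDef => //; apply/diff_locallyP; rewrite dA.
Unshelve. all: by end_near. Qed.

Lemma is_diff_ext (f : V -> W) (x : V) (df dg : V -> W) :
  is_diff x f df -> df =1 dg -> is_diff x f dg.
Proof. by move=> fdf /funext <-. Qed.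

(** Pointwise form of the library rule, suited to functions written as abstractions; likewise for
    the rules that follow. *)
Lemma is_diff_add (f g : V -> W) (x : V) (df dg : V -> W) :
  is_diff x f df -> is_diff x g dg ->
  is_diff x (fun y => f y + g y) (fun h => df h + dg h).
Proof. exact: is_diffD. Qed.

Lemma is_diff_scale (f : V -> W) (x : V) (df : V -> W) (k : R) :
  is_diff x f df -> is_diff x (fun y => k *: f y) (fun h => k *: df h).
Proof. exact: is_diffZ. Qed.

Lemma is_diff_shift (f : V -> W) (x : V) (df : V -> W) (a : W) :
  is_diff x f df -> is_diff x (fun y => f y - a) df.
Proof.
move=> fdf; have := is_diff_add fdf (is_diff_cst (- a) x).
by move=> /is_diff_ext; apply => h; rewrite addr0.
Qed.

Lemma is_diff_cst_add (f : V -> W) (x : V) (df : V -> W) (a : W) :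
  is_diff x f df -> is_diff x (fun y => a + f y) df.
Proof.
move=> fdf; have := is_diff_add (is_diff_cst a x) fdf.
by move=> /is_diff_ext; apply => h; rewrite add0r.
Qed.

Lemma is_diff_linear (A : {linear V -> W}) (x : V) : continuous A -> is_diff x A A.
Proof.
by move=> cA; apply: DiffDef; [exact: linear_differentiable|exact: diff_lin].
Qed.

End Differentials.

Section ProductProjections.
Context {R : realType} {V W U : normedModType R}.

Lemma is_diff_comp_fst (f df : V -> U) (z : V * W) :
  is_diff (z.1) f df -> is_diff z (fun p => f p.1) (fun h => df h.1).
Proof.
move=> fdf; apply: (is_diff_comp (f := fst) (df := fst) (g := f) (dg := df)) => //.
by apply: is_diff_linear => p; exact: cvg_fst.
Qed.

Lemma is_diff_comp_snd (f df : W -> U) (z : V * W) :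
  is_diff (z.2) f df -> is_diff z (fun p => f p.2) (fun h => df h.2).
Proof.
move=> fdf; apply: (is_diff_comp (f := snd) (df := snd) (g := f) (dg := df)) => //.
by apply: is_diff_linear => p; exact: cvg_snd.
Qed.

End ProductProjections.

(** * Gradients and adjoints as Riesz representatives *)

Section GradientAdjoint.
Context {R : realType} {V W : normedModType R}.
Variables (ipV : V -> V -> R).
Hypothesis ipV_ext : forall u v, (forall h, ipV u h = ipV v h) -> u = v.

(** Nondegeneracy makes the chosen representative unique. Keeping [ipV] abstract covers both [inner]
    and [pair_inner]. *)
Lemma gradient_eq (f : V -> R) (x v : V) :
  is_diff x f (ipV v) -> gradient ipV f x = v.
Proof.
move=> fv; apply: xget_unique => [h|u uf]; first by rewrite diff_val.
by apply: ipV_ext => h; rewrite uf diff_val.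
Qed.

Lemma adjoint_eq (ipW : W -> W -> R) (A : V -> W) (y : W) (v : V) :
  (forall h, ipV v h = ipW y (A h)) -> adjoint ipV ipW A y = v.
Proof.
by move=> vA; apply: xget_unique => // u uA; apply: ipV_ext => h; rewrite uA vA.
Qed.

End GradientAdjoint.

Lemma is_diff_norm_sqr (R : realType) (X : hilbertType R) (x : X) :
  is_diff x (fun y : X => `|y| ^+ 2) (fun h => 2 * inner x h).
Proof.
have quad : is_diff x (fun y : X => `|y| ^+ 2) (inner (2 *: x)).
  (* The remainder of the expansion is exactly [|h| ^+ 2], hence the constant 1. *)
  apply: (is_diff_quadratic (K := 1)); first exact: inner_continuous_r.
  move=> h; rewrite -[X in _ - X]/(inner (2 *: x) h) innerZl normD_sqr mul1r.
  rewrite le_eqVlt; apply/orP; left; apply/eqP.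
  rewrite -[RHS]ger0_norm ?sqr_ge0//; congr `|_|; ring.
by apply: is_diff_ext quad _ => h; rewrite innerZl.
Qed.

Lemma is_diff_half_dist_sqr (R : realType) (V : hilbertType R) (v vh : V) :
  is_diff v (fun u => 2^-1 * `|u - vh| ^+ 2) (inner (v - vh)).
Proof.
have := is_diff_comp (is_diff_shift vh (is_diff_id v))
  (is_diff_norm_sqr (v - vh)).
move=> /(is_diff_scale 2^-1) /is_diff_ext; apply => h /=.
by rewrite -[LHS]/(2^-1 * (2 * _)); field.
Qed.

Section HilbertDifferentials.
Context {R : realType} {X Y : hilbertType R}.

Lemma pair_inner_ext (u v : Y * X) :
  (forall h, pair_inner inner inner u h = pair_inner inner inner v h) -> u = v.
Proof.
move=> uv; rewrite [u]surjective_pairing [v]surjective_pairing.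
congr pair; apply: inner_ext => h.
  by have := uv (h, 0); rewrite /pair_inner/= !inner0r !addr0.
by have := uv (0, h); rewrite /pair_inner/= !inner0r !add0r.
Qed.

(** Riesz representation shows that a representative exists, so [xget] does not fall back on its
    default. *)
Lemma gradientP (f : X -> R) (x : X) :
  differentiable f x -> is_diff x f (inner (gradient inner f x)).
Proof.
move=> fx; have [v vf] := riesz_representation (diff_continuous fx).
suff fv : is_diff x f (inner v) by rewrite (gradient_eq inner_ext fv).
by apply: DiffDef => //; apply/funext => h; rewrite vf.
Qed.

Lemma adjointP (A : {linear X -> Y}) (y : Y) (h : X) : continuous A ->
  inner (adjoint inner inner A y) h = inner y (A h).
Proof.
move=> cA; have lin : linear (fun h => inner y (A h)).
  by move=> k u v; rewrite linearP innerDr innerZr.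
pose yA : {linear X -> R} := HB.pack (fun h => inner y (A h))
  (GRing.isLinear.Build _ _ _ _ _ lin).
have cyA : continuous yA.
  by move=> u; apply: continuous_comp; [exact: cA|exact: inner_continuous_r].
have [v vA] := riesz_representation cyA.
by rewrite (adjoint_eq inner_ext vA) vA.
Qed.

Lemma is_diff_inner_comp (c : X -> Y) (y : Y) (x : X) : differentiable c x ->
  is_diff x (fun x' => inner y (c x')) (inner (adjoint inner inner ('d c x) y)).
Proof.
move=> cx.
have yy : is_diff (c x) (inner y) (inner y).
  by apply: is_diff_linear; exact: inner_continuous_r.
have := is_diff_comp (differentiableP cx) yy.
move=> /is_diff_ext; apply => h /=.
by rewrite adjointP//; exact: diff_continuous.
Qed.

Lemma is_diff_norm_sqr_comp (c : X -> Y) (x : X) : differentiable c x ->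
  is_diff x (fun x' => `|c x'| ^+ 2)
    (inner (2 *: adjoint inner inner ('d c x) (c x))).
Proof.
move=> cx.
have := is_diff_comp (differentiableP cx) (is_diff_norm_sqr (c x)).
move=> /is_diff_ext; apply => h /=.
by rewrite innerZl adjointP//; exact: diff_continuous.
Qed.

End HilbertDifferentials.

(** * Tangent cones and their polars *)

Lemma tangent_cone_direction (R : realType) (V : normedModType R) (M : set V)
    (x v : V) : (forall t, 0 <= t <= 1 -> M (x + t *: v)) -> tangent_cone M x v.
Proof.
move=> Mv; exists (fun k => x + k.+1%:R^-1 *: v), (fun k => k.+1%:R); split => //.
- by move=> k; apply: Mv; rewrite invr_ge0 ler0n invf_le1// ler1n.
- rewrite -[X in _ --> X]addr0; apply: cvgD; first exact: cvg_cst.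
  by rewrite -[X in _ --> X](scale0r v); apply: cvgZr_tmp; exact: cvg_harmonic.
- rewrite (_ : (fun k => _) = cst v); first exact: cvg_cst.
  apply/funext => k /=.
  by rewrite [x + _]addrC addrK scalerA divff ?scale1r// pnatr_eq0.
Qed.

Section PolarCones.
Context {R : realType} {X Y : hilbertType R}.

(** Each [q - x] is tangent by convexity. Conversely, tangent vectors are limits of nonnegative
    multiples of such differences, and the inequality passes to the limit. *)
Lemma polar_tangent_cone_convex (C : set X) (x d : X) :
  convex_set (C : set (convex_lmodType X)) -> C x ->
  polar_tangent_cone inner C x d <-> forall q, C q -> inner d (q - x) <= 0.
Proof.
move=> cC Cx; split=> [dC q Cq|dC v [xs [ls [Cxs ls0 _ xsv]]]].
  apply: dC; apply: tangent_cone_direction => t t01.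
  exact: convex_set_segment.
have dv : inner d (ls k *: (xs k - x)) @[k --> \oo] --> inner d v.
  exact: (cvg_comp _ _ xsv (@inner_continuous_r _ _ d v)).
apply: ler_cvg_to dv (cvg_cst (0 : R)) _; apply: nearW => k.
by rewrite innerZr mulr_ge0_le0// dC.
Qed.

Lemma polar_tangent_cone_setX (C : set X) (w : Y) (x : X) (a : Y) (b : X) : C x ->
  polar_tangent_cone (pair_inner inner inner) (setT `*` C) (w, x) (a, b) <->
  a = 0 /\ polar_tangent_cone inner C x b.
Proof.
move=> Cx; split=> [ab|[-> bC] d [xs [ls [Cxs ls0 xsx xsd]]]].
  split=> [|v [xs [ls [Cxs ls0 xsx xsv]]]].
    (* The first factor is all of [Y], so [a] itself is a tangent direction; testing with it yields
       [|a| ^+ 2 <= 0]. *)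
    have : tangent_cone (setT `*` C) (w, x) (a, 0).
      apply: tangent_cone_direction => t _; split => //.
      by rewrite /= scaler0 addr0.
    move=> /ab; rewrite /pair_inner/= inner0r addr0 inner_norm => a0.
    apply/eqP; rewrite -normr_eq0 -sqrf_eq0 eq_le sqr_ge0 andbT.
    exact: a0.
  have : tangent_cone (setT `*` C) (w, x) (0, v).
    exists (fun k => (w, xs k)), ls; split => //.
    - by move=> k; split => //=; exact: Cxs.
    - by apply: cvg_pair => //; exact: cvg_cst.
    - rewrite (_ : (fun k => _) = fun k => (0, ls k *: (xs k - x))).
        by apply: cvg_pair => //; exact: cvg_cst.
      by apply/funext => k; congr pair; rewrite /= subrr scaler0.
  by move=> /ab; rewrite /pair_inner/= inner0r add0r.
rewrite /pair_inner/= inner0l add0r; apply: bC.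
exists (fun k => (xs k).2), ls; split => //.
- by move=> k; have [] := Cxs k.
- exact: (cvg_comp _ _ xsx cvg_snd).
- exact: (cvg_comp _ _ xsd cvg_snd).
Qed.

End PolarCones.

(** * Derivatives and stationarity of the regularized problem *)

Section KKT.
Context {R : realType} {X Y : hilbertType R}.
Variables (phi : X -> R) (c : X -> Y) (rho : R).
Hypothesis phi_diff : forall x, differentiable phi x.
Hypothesis c_diff : forall x, differentiable c x.

Let dc_cont x : continuous ('d c x) := diff_continuous (c_diff x).

Lemma is_diff_penalized x : is_diff x (penalized phi c rho)
  (inner (gradient inner phi x + rho *: adjoint inner inner ('d c x) (c x))).
Proof.
have := is_diff_add (gradientP (phi_diff x))
  (is_diff_scale (rho / 2) (is_diff_norm_sqr_comp (c_diff x))).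
move=> /is_diff_ext; apply => h /=.
rewrite innerDl; congr (_ + _).
by rewrite !innerZl -[LHS]/(rho / 2 * _); field.
Qed.

Lemma grad_xE x y : grad_x phi c rho x y =
  gradient inner phi x + rho *: adjoint inner inner ('d c x) (c x) +
  adjoint inner inner ('d c x) y.
Proof.
apply: (gradient_eq inner_ext).
have := is_diff_add (is_diff_penalized x) (is_diff_inner_comp y (c_diff x)).
move=> /is_diff_ext; apply => h /=.
by rewrite !innerDl.
Qed.

Lemma grad_yE x y : grad_y phi c rho x y = c x.
Proof.
apply: (gradient_eq inner_ext).
have := is_diff_linear y (@inner_continuous_r _ _ (c x)).
move=> /(is_diff_cst_add (penalized phi c rho x)).
have -> // : (fun y' => penalized phi c rho x + inner (c x) y') =
  (fun y' => lagrangian phi c rho (x, y')).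
by apply/funext => y'; rewrite /lagrangian/= innerC.
Qed.

Variables (xh : X) (yh : Y) (lambda : R).

Lemma gradient_reg_objective w x :
  gradient (pair_inner inner inner) (reg_objective phi c rho xh yh lambda) (w, x) =
  (lambda *: (w - yh), gradient inner phi x +
    rho *: adjoint inner inner ('d c x) (c x) + lambda *: (x - xh)).
Proof.
apply: (gradient_eq pair_inner_ext).
have d1 := @is_diff_comp_snd _ _ _ _ _ _ (w, x) (is_diff_penalized x).
have d2 := @is_diff_comp_snd _ Y _ _ _ _ (w, x) (is_diff_half_dist_sqr x xh).
have d3 := @is_diff_comp_fst _ _ X _ _ _ (w, x) (is_diff_half_dist_sqr w yh).
have := is_diff_add d1 (is_diff_scale lambda (is_diff_add d2 d3)).
move=> /is_diff_ext; apply => h /=.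
rewrite /pair_inner/= -[X in _ + X = _]/(lambda * _) !innerE; ring.
Qed.

Lemma is_diff_reg_constraint w x :
  is_diff (w, x) (reg_constraint c lambda) (fun h => 'd c x h.2 + lambda *: h.1).
Proof.
have d1 := @is_diff_comp_snd _ Y _ _ _ _ (w, x) (differentiableP (c_diff x)).
have d2 := @is_diff_comp_fst _ _ X _ _ _ (w, x) (is_diff_scaler lambda w).
exact: is_diff_add d1 d2.
Qed.

Lemma adjoint_reg_constraint w x y :
  adjoint (pair_inner inner inner) inner ('d (reg_constraint c lambda) (w, x)) y =
  (lambda *: y, adjoint inner inner ('d c x) y).
Proof.
apply: (adjoint_eq pair_inner_ext) => h.
have -> : 'd (reg_constraint c lambda) (w, x) h = 'd c x h.2 + lambda *: h.1.
  by have /(@diff_val _ _ _ _ _ _ _)-> := is_diff_reg_constraint w x.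
by rewrite /pair_inner/= adjointP// !innerE addrC.
Qed.

(** The polar cone of the product splits stationarity into an equation for [w] and a polar condition
    for [x]. No sign of [lambda] is assumed, so the case [lambda = 0] is included. *)
Lemma reg_stationary (C : set X) w x y : C x ->
  polar_tangent_cone (pair_inner inner inner) (setT `*` C) (w, x)
    (- gradient (pair_inner inner inner)
         (reg_objective phi c rho xh yh lambda) (w, x)
     - adjoint (pair_inner inner inner) inner
         ('d (reg_constraint c lambda) (w, x)) y)
  <-> lambda *: (w - yh + y) = 0 /\
      polar_tangent_cone inner C x
        (- (grad_x phi c rho x y + lambda *: (x - xh))).
Proof.
move=> Cx; rewrite gradient_reg_objective adjoint_reg_constraint.
rewrite -[X in polar_tangent_cone _ _ _ X]/(_, _) /= polar_tangent_cone_setX//.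
set a := (X in X = 0 /\ _); set b := polar_tangent_cone _ _ _ _.
have -> : a = - (lambda *: (w - yh + y)) by rewrite /a [in RHS]scalerDr opprD.
have -> : b = polar_tangent_cone inner C x
    (- (grad_x phi c rho x y + lambda *: (x - xh))).
  by congr polar_tangent_cone; rewrite grad_xE -opprD addrAC.
split=> -[a0 bC]; split => //; first by apply/eqP; rewrite -oppr_eq0 a0.
by rewrite a0 oppr0.
Qed.

End KKT.

(** * Continuous differentiability and the constraint qualification *)

Lemma twice_continuously_differentiable_C1 (R : realType) (V W : normedModType R)
    (f : V -> W) :
  twice_continuously_differentiable f -> continuously_differentiable_on setT f.
Proof.
move=> [df [f2 [f2_bound f2_deriv _]]]; split=> // x _ e e0.
have [M Mx] := f2_bound x.
(* [|M|] bounds the second derivative at [x], and 1 is the tolerance chosen below for its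
   remainder. *)
have M1 : 0 < `|M| + 1 by rewrite ltr_wpDl.
have eM : 0 < e / (`|M| + 1) by rewrite divr_gt0.
suff : \forall h \near (0 : V), forall k,
    `|'d f (x + h) k - 'd f x k| <= e * `|k|.
  move=> near0; rewrite (near_shift 0 x); apply: filterS near0 => h dh k.
  by rewrite /= subr0 [h + x]addrC; exact: dh.
near=> h => k.
have h1 : `|'d f (x + h) k - 'd f x k - f2 x h k| <= 1 * `|h| * `|k|.
  by move: k; near: h; exact: f2_deriv.
have h2 : `|h| <= e / (`|M| + 1) by near: h; exact: nbhs0_le.
have -> : 'd f (x + h) k - 'd f x k =
    ('d f (x + h) k - 'd f x k - f2 x h k) + f2 x h k.
  by rewrite subrK.
apply: le_trans (ler_normD _ _) _; apply: le_trans (lerD h1 (Mx h k)) _.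
rewrite -!mulrA -mulrDl mulrA ler_wpM2r//; rewrite mulrC.
move: h2; rewrite ler_pdivlMr//; apply: le_trans.
by rewrite ler_wpM2l// addrC lerD2r ler_norm.
Unshelve. all: by end_near. Qed.

(** The constraint is solved for [w] by [- lambda^-1 *: c x], which is continuously differentiable
    on the whole space. The partial derivative in [w] is multiplication by [lambda], which is
    invertible and self-adjoint. *)
Lemma reg_strong_constraint_qualification (R : realType) (X Y : hilbertType R)
    (C : set X) (c : X -> Y) (lambda : R) :
  continuously_differentiable_on setT c -> 0 < lambda ->
  strong_constraint_qualification C (reg_constraint c lambda).
Proof.
move=> [dc dc_cont] l0; have l_neq0 : lambda != 0 by rewrite gt_eqF.
exists (fun x => - lambda^-1 *: c x); split=> [|w x Cx].
  exists setT, (fun x => - lambda^-1 *: c x).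
  split; [exact: openT|exact: subsetT|exact: in1W|].
  have dS x : is_diff x (fun x => - lambda^-1 *: c x)
      (fun h => - lambda^-1 *: 'd c x h).
    by apply: is_diff_scale; apply: differentiableP; exact: dc.
  split=> [x _|x _ e e0]; first by have [] := dS x.
  have el : 0 < e * lambda by rewrite mulr_gt0.
  have := dc_cont x I _ el; apply: filterS => x' dcx' h.
  rewrite (diff_val (is_diff_def := dS x)) (diff_val (is_diff_def := dS x')).
  rewrite -scalerBr normrZ normrN gtr0_norm ?invr_gt0// ler_pdivrMl//.
  by rewrite mulrA [lambda * _]mulrC.
have dw : 'd (fun w' => reg_constraint c lambda (w', x)) w = *:%R lambda :> (Y -> Y).
  have := is_diff_cst_add (c x) (is_diff_scaler lambda w).
  by move=> /(@diff_val _ _ _ _ _ _ _).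
have surj : range ( *:%R lambda : Y -> Y) = setT.
  apply/seteqP; split => // y _; exists (lambda^-1 *: y) => //.
  by rewrite scalerA divff ?scale1r.
split.
- rewrite /reg_constraint/=; split=> [/eqP|->].
    rewrite addr_eq0 => /eqP ->.
    by rewrite scalerN scaleNr opprK scalerA mulVf ?scale1r.
  by rewrite scalerA mulrN divff// scaleN1r subrr.
- by rewrite dw.
- rewrite dw (_ : adjoint _ _ _ = *:%R lambda)//; apply/funext => y.
  by apply: (adjoint_eq inner_ext) => h; rewrite !innerE.
Qed.

(** * Descent inequality and projection form of stationarity *)

Section Descent.
Context {R : realType} {X : hilbertType R}.

(** The mean value theorem on the segment, with Cauchy-Schwarz for the gradient difference, gives
    the constant [M] in place of the sharp [M / 2]. *)
Lemma lipschitz_gradient_lower_bound (f : X -> R) (g : X -> X) (M : R) (x x' : X) :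
  (forall u, is_diff u f (inner (g u))) ->
  (forall u v, `|g u - g v| <= M * `|u - v|) ->
  f x + inner (g x) (x' - x) - M * `|x' - x| ^+ 2 <= f x'.
Proof.
move=> fg gM; set d := x' - x; pose F t := f (x + t *: d).
have dF (t : R) : is_derive t 1 F (inner (g (x + t *: d)) d).
  have daff : is_diff t (fun s => x + s *: d) ( *:%R ^~ d).
    exact: is_diff_cst_add (is_diff_scalel t d).
  have dFt := is_diff_comp daff (fg _).
  have Ft : differentiable F t by case: dFt.
  apply: DeriveDef; first exact: diff_derivable.
  by rewrite deriveE// (diff_val (is_diff_def := dFt))/= scale1r.
have Fcont : {within `[0, 1], continuous F}.
  apply: continuous_subspaceT => t; apply: differentiable_continuous.
  by apply/derivable1_diffP; case: (dF t).
have [t] := MVT_segment ler01 (fun t _ => dF t) Fcont.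
rewrite in_itv/= subr0 mulr1 /F scale1r scale0r addr0 => /andP[t0 t1].
have -> : x + d = x' by rewrite /d addrC subrK.
move=> fx'; have fx'E : f x' = f x + inner (g (x + t *: d)) d.
  by rewrite -fx' addrC subrK.
have dg : `|inner (g (x + t *: d) - g x) d| <= M * `|d| ^+ 2.
  apply: le_trans (cauchy_schwarz _ _) _.
  rewrite expr2 mulrA ler_wpM2r//; apply: le_trans (gM _ _) _.
  have M0 : 0 <= M * `|d|.
    by apply: le_trans (gM x' x); exact: normr_ge0.
  rewrite [x + _]addrC addrK normrZ ger0_norm// mulrCA.
  by rewrite ler_piMl.
move: dg; rewrite innerDl innerNl ler_norml => /andP[dg _].
rewrite fx'E; lra.
Qed.

End Descent.

(** The polar vector is [lambda] times the residual [xh - lambda^-1 *: v - x], and a positive factor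
    leaves the variational inequality of the projection unchanged. *)
Lemma polar_tangent_cone_projection (R : realType) (X : hilbertType R)
    (C : set X) (x xh v : X) (lambda : R) :
  closed C -> convex_set (C : set (convex_lmodType X)) -> 0 < lambda -> C x ->
  polar_tangent_cone inner C x (- (v + lambda *: (x - xh))) <->
  metric_projection C (xh - lambda^-1 *: v) = x.
Proof.
move=> clC cC l0 Cx; rewrite polar_tangent_cone_convex//.
have -> : - (v + lambda *: (x - xh)) = lambda *: (xh - lambda^-1 *: v - x).
  rewrite !scalerBr scalerA divff ?gt_eqF// scale1r opprD opprB addrC.
  by rewrite addrAC.
split=> [vC|projx].
  apply: metric_projection_unique => // q Cq.
  by have := vC q Cq; rewrite innerZl pmulr_rle0.
move=> q Cq; rewrite innerZl pmulr_rle0//.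
have [_] := metric_projectionP cC (xh - lambda^-1 *: v) clC (ex_intro _ x Cx).
by rewrite projx; apply.
Qed.

(** * Solutions of the regularized problem and the projected Euler equations *)

Section ProjectedEuler.
Context {R : realType} {X Y : hilbertType R}.
Variables (C : set X) (phi : X -> R) (c : X -> Y) (rho : R) (xh : X) (yh : Y).
Hypothesis C_closed : closed C.
Hypothesis C_convex : convex_set (C : set (convex_lmodType X)).
Hypothesis phi_diff : forall x, differentiable phi x.
Hypothesis c_diff : forall x, differentiable c x.

(** Feasibility fixes [w], stationarity in [w] gives [y = yh - w], and stationarity in [x] is the
    projection equation. *)
Lemma reg_solution_euler (lambda : R) w x y : 0 < lambda ->
  reg_solution C phi c rho xh yh lambda (w, x) y ->
  [/\ C x, w = - (lambda^-1 *: c x), y = yh + lambda^-1 *: c x &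
      metric_projection C (xh - lambda^-1 *: grad_x phi c rho x y) = x].
Proof.
move=> l0 [[[_ /= Cx] feas _] /(reg_stationary _ phi_diff c_diff _ _ _ _ _ Cx)[wy]].
move=> /(polar_tangent_cone_projection _ _ C_closed C_convex l0 Cx) projx.
have l_neq0 : lambda != 0 by rewrite gt_eqF.
have wE : w = - (lambda^-1 *: c x).
  have /eqP : c x + lambda *: w = 0 := feas.
  rewrite addr_eq0 => /eqP ->.
  by rewrite scalerN opprK scalerA mulVf// scale1r.
split=> //; move/eqP: wy; rewrite scaler_eq0 (negbTE l_neq0)/= addrC addr_eq0.
by move=> /eqP ->; rewrite opprB wE opprK.
Qed.

(** At [lambda = 0] the variable [w] drops out and its stationarity equation is trivial; at feasible
    points the penalty and its gradient vanish. *)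
Lemma reg_solution0 w x y :
  reg_solution C phi c rho xh yh 0 (w, x) y <->
  primal_dual_solution inner inner phi C c x y.
Proof.
have feasE z : reg_constraint c 0 z = c z.2.
  by rewrite /reg_constraint scale0r addr0.
have objE z : c z.2 = 0 -> reg_objective phi c rho xh yh 0 z = phi z.2.
  move=> cz; rewrite /reg_objective /penalized cz normr0.
  by rewrite expr0n/= mulr0 mul0r !addr0.
have polarE : C x -> c x = 0 ->
    polar_tangent_cone (pair_inner inner inner) (setT `*` C) (w, x)
    (- gradient (pair_inner inner inner)
         (reg_objective phi c rho xh yh 0) (w, x)
     - adjoint (pair_inner inner inner) inner
         ('d (reg_constraint c 0) (w, x)) y)
    <-> polar_tangent_cone inner C x
      (- gradient inner phi x - adjoint inner inner ('d c x) y).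
  move=> Cx cx0; rewrite reg_stationary// !scale0r addr0 grad_xE// cx0.
  have -> : adjoint inner inner ('d c x) (0 : Y) = 0.
    by apply: (adjoint_eq inner_ext) => h; rewrite !inner0l.
  rewrite scaler0 addr0 opprD.
  by split=> [[]|].
split.
  move=> [[[_ /= Cx]]]; rewrite feasE => cx0 locmin /(polarE Cx cx0) stat.
  split=> //; split=> //.
  (* Local minimality is restricted to the slice with [w] fixed. *)
  have snd_near : (w, x') @[x' --> x] --> (w, x).
    exact: (cvg_pair (cvg_cst w) cvg_id).
  have : \forall x' \near x, (setT `*` C) (w, x') ->
      reg_constraint c 0 (w, x') = 0 ->
      reg_objective phi c rho xh yh 0 (w, x) <=
      reg_objective phi c rho xh yh 0 (w, x').
    exact: snd_near locmin.
  apply: filterS => x' min Cx' cx'0.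
  by move: min; rewrite feasE !objE//=; apply.
move=> [[Cx cx0 locmin] /(polarE Cx cx0) stat]; split=> //.
split=> //; first by rewrite feasE.
have : \forall z \near (w, x), C z.2 -> c z.2 = 0 -> phi x <= phi z.2.
  exact: (@cvg_snd _ _ (nbhs w) (nbhs x) _) locmin.
apply: filterS => -[w' x'] /= min [_ /= Cx']; rewrite feasE => /= cx'0.
by rewrite !objE//=; apply: min.
Qed.

(** * Contraction, minimality and convergence under a global Lipschitz bound *)

Variable M : R.
Hypothesis gradL_lipschitz : forall p q,
  `|grad_lagrangian phi c rho p - grad_lagrangian phi c rho q| <= M * `|p - q|.
Hypothesis M_gt0 : 0 < M.

Lemma grad_x_lipschitz x y x' y' :
  `|grad_x phi c rho x y - grad_x phi c rho x' y'| <=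
  M * Num.max `|x - x'| `|y - y'|.
Proof.
apply: le_trans (gradL_lipschitz (x, y) (x', y')).
by rewrite prod_normE/= le_max lexx.
Qed.

(** [c] is the [y] component of the gradient of the Lagrangian and inherits its constant. *)
Lemma constraint_lipschitz x x' : `|c x - c x'| <= M * `|x - x'|.
Proof.
have := gradL_lipschitz (x, 0) (x', 0).
rewrite /grad_lagrangian/= !grad_yE// !prod_normE/= subrr normr0.
by rewrite (max_l (normr_ge0 _)); apply: le_trans; rewrite le_max lexx orbT.
Qed.

(** The multiplier is eliminated here through the second Euler equation. *)
Definition euler_grad (dt : R) (x : X) : X :=
  grad_x phi c rho x (yh + dt *: c x).

(** Under [dt * M <= 1] the eliminated multiplier moves no further than [x], so in the maximum norm
    of the product the constant remains [M]. *)
Lemma euler_grad_lipschitz (dt : R) x x' : 0 <= dt -> dt * M <= 1 ->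
  `|euler_grad dt x - euler_grad dt x'| <= M * `|x - x'|.
Proof.
move=> dt0 dtM; apply: le_trans (grad_x_lipschitz _ _ _ _) _.
rewrite ler_pM2l// ge_max lexx/=.
rewrite opprD addrACA subrr add0r -scalerBr normrZ ger0_norm//.
apply: le_trans (ler_wpM2l dt0 (constraint_lipschitz _ _)) _.
by rewrite mulrA ler_piMl.
Qed.

Definition euler_map (dt : R) (x : X) : X :=
  metric_projection C (xh - dt *: euler_grad dt x).

Lemma euler_map_lipschitz (dt : R) x x' : C !=set0 -> 0 <= dt -> dt * M <= 2^-1 ->
  `|euler_map dt x - euler_map dt x'| <= 2^-1 * `|x - x'|.
Proof.
move=> C0 dt0 dtM.
apply: le_trans (metric_projection_nonexpansive C_convex _ _ C_closed C0) _.
rewrite opprD opprK addrACA subrr add0r addrC -scalerBr normrZ ger0_norm//.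
apply: le_trans (ler_wpM2l dt0 (euler_grad_lipschitz _ _ dt0 _)) _; first lra.
by rewrite mulrA distrC ler_wpM2r.
Qed.

Lemma euler_map_fixed_point (dt : R) : C !=set0 -> 0 <= dt -> dt * M <= 2^-1 ->
  exists2 x, C x & x = euler_map dt x.
Proof.
move=> C0 dt0 dtM.
have funC : set_fun C C (euler_map dt).
  move=> x Cx; rewrite /euler_map; set z := xh - _.
  by have [] := metric_projectionP C_convex z C_closed C0.
pose T : {fun C >-> C} := HB.pack (euler_map dt) (isFun.Build _ _ C C _ funC).
apply: (@banach_fixed_point _ _ C T) => //.
exists (2^-1)%:nng; split=> /=; first by rewrite invf_lt1// ltr1n.
by move=> [x x'] _ /=; exact: euler_map_lipschitz.
Qed.

Lemma euler_map_fixed_point_unique (dt : R) x x' : C !=set0 -> 0 <= dt ->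
  dt * M <= 2^-1 -> x = euler_map dt x -> x' = euler_map dt x' -> x = x'.
Proof.
move=> C0 dt0 dtM Tx Tx'; have := euler_map_lipschitz x x' C0 dt0 dtM.
rewrite -Tx -Tx' => xx'; apply/eqP.
by rewrite -subr_eq0 -normr_eq0 eq_le normr_ge0 andbT; lra.
Qed.

(** Exhibits [euler_grad] as a gradient, as the descent inequality requires. For [dt = lambda^-1]
    the function is the objective after elimination of [w], up to a constant and the proximal term
    in [x]. *)
Lemma is_diff_reduced_lagrangian (dt : R) x :
  is_diff x
    (fun u => penalized phi c rho u + inner yh (c u) + dt / 2 * `|c u| ^+ 2)
    (inner (euler_grad dt x)).
Proof.
have := is_diff_add (is_diff_add (is_diff_penalized rho phi_diff c_diff x)
  (is_diff_inner_comp yh (c_diff x)))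
  (is_diff_scale (dt / 2) (is_diff_norm_sqr_comp (c_diff x))).
move=> /is_diff_ext; apply => h /=.
rewrite -[X in _ + X = _]/(dt / 2 * _) /euler_grad grad_xE// !innerE.
have dc := diff_continuous (c_diff x).
by rewrite !adjointP// !innerE; field.
Qed.

(** The fixed point equation is a variational inequality at [x]. The descent inequality loses
    [M * |x' - x| ^+ 2], while the proximal term gains [lambda / 2 * |x' - x| ^+ 2], which suffices
    because [2 * M <= lambda]. *)
Lemma euler_fixed_point_minimizer (lambda : R) x x' : 0 < lambda ->
  lambda^-1 * M <= 2^-1 -> C x -> x = euler_map lambda^-1 x -> C x' ->
  reg_objective phi c rho xh yh lambda (- (lambda^-1 *: c x), x) <=
  reg_objective phi c rho xh yh lambda (- (lambda^-1 *: c x'), x').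
Proof.
move=> l0 lM Cx /esym /(polar_tangent_cone_projection _ _ C_closed C_convex l0 Cx).
move=> /(polar_tangent_cone_convex _ C_convex Cx) stat Cx'.
have := stat x' Cx'; rewrite innerNl innerDl innerZl => {}stat.
set dt := lambda^-1 in lM stat *.
have dt0 : 0 <= dt by rewrite invr_ge0 ltW.
have ldt : lambda * dt = 1 by rewrite divff// gt_eqF.
have := lipschitz_gradient_lower_bound x x' (is_diff_reduced_lagrangian dt)
  (fun u v => @euler_grad_lipschitz dt u v dt0 ltac:(lra)).
(* Expanding [lambda / 2 * |w - yh| ^+ 2] at [w = - (dt *: c u)] with [lambda * dt = 1] produces the
   two terms in [c u] and the constant. *)
have objE u : reg_objective phi c rho xh yh lambda (- (dt *: c u), u) =
    penalized phi c rho u + inner yh (c u) + dt / 2 * `|c u| ^+ 2 +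
    lambda / 2 * `|u - xh| ^+ 2 + lambda / 2 * `|yh| ^+ 2.
  rewrite /reg_objective/= -opprD normrN (normD_sqr (dt *: c u)) innerZl.
  rewrite normrZ exprMn -normrX ger0_norm ?sqr_ge0// [inner (c u) yh]innerC.
  transitivity (penalized phi c rho u + (lambda * dt) * inner yh (c u) +
    (lambda * dt) * (dt / 2 * `|c u| ^+ 2) + lambda / 2 * `|u - xh| ^+ 2 +
    lambda / 2 * `|yh| ^+ 2); first by field.
  by rewrite ldt !mul1r.
rewrite !objE.
have -> : x' - xh = (x - xh) + (x' - x) by rewrite [RHS]addrC addrA subrK.
rewrite (normD_sqr (x - xh)).
have Ml : 2 * M <= lambda.
  have := ler_wpM2l (ltW l0) lM; rewrite mulrA ldt mul1r; lra.
have := mulr_ge0 (ltW l0) (sqr_ge0 `|x' - x|).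
have := ler_wpM2r (sqr_ge0 `|x' - x|) Ml.
move: stat; set a := inner _ _; set b := inner _ _; set d := _ ^+ 2.
lra.
Qed.

Lemma reg_solution_of_fixed_point (lambda : R) x : 0 < lambda ->
  lambda^-1 * M <= 2^-1 -> C x -> x = euler_map lambda^-1 x ->
  reg_solution C phi c rho xh yh lambda (- (lambda^-1 *: c x), x)
    (yh + lambda^-1 *: c x).
Proof.
move=> l0 lM Cx Tx; have l_neq0 : lambda != 0 by rewrite gt_eqF.
have feasE w' x' :
    reg_constraint c lambda (w', x') = 0 <-> w' = - (lambda^-1 *: c x').
  rewrite /reg_constraint/=; split=> [/eqP|->].
    rewrite addr_eq0 => /eqP ->.
    by rewrite scalerN opprK scalerA mulVf// scale1r.
  by rewrite scalerN scalerA divff// scale1r subrr.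
split; first split=> //; first exact/feasE.
  (* Minimality is global, and feasible points are parametrized by their [x] component. *)
  apply: (@nearW _ (nbhs (- (lambda^-1 *: c x), x))).
  move=> -[w' x'] [_ /= Cx'] /feasE ->.
  exact: euler_fixed_point_minimizer.
apply/reg_stationary => //; split.
  by rewrite -opprD [yh + _]addrC addNr scaler0.
by apply/(polar_tangent_cone_projection _ _ C_closed C_convex l0 Cx).
Qed.

(** Every solution has as [x] component a fixed point of the contraction, and the Euler equations
    recover [w] and [y] from it. *)
Lemma reg_solution_unique_existence (lambda : R) : C !=set0 -> 0 < lambda ->
  lambda^-1 * M <= 2^-1 ->
  exists! s : Y * X * Y, reg_solution C phi c rho xh yh lambda s.1 s.2.
Proof.
move=> C0 l0 lM; have dt0 : 0 <= lambda^-1 by rewrite invr_ge0 ltW.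
have [x Cx Tx] := euler_map_fixed_point C0 dt0 lM.
exists (- (lambda^-1 *: c x), x, yh + lambda^-1 *: c x).
split=> [|[[w' x'] y'] /= /(reg_solution_euler l0)[Cx' -> yE]].
  exact: reg_solution_of_fixed_point.
rewrite yE => /esym Tx'.
by rewrite (euler_map_fixed_point_unique C0 dt0 lM Tx Tx').
Qed.

Lemma reg_solution_dist (lambda : R) (s : Y * X * Y) : C xh -> 0 < lambda ->
  lambda^-1 * M <= 2^-1 -> lambda^-1 <= 1 ->
  reg_solution C phi c rho xh yh lambda s.1 s.2 ->
  `|(0, xh, yh) - s| <= lambda^-1 * (2 * (`|grad_x phi c rho xh yh| + `|c xh|)).
Proof.
move=> Cxh l0 lM dt1; case: s => [[w x] y] /= /(reg_solution_euler l0)[Cx -> ->].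
set dt := lambda^-1 in lM dt1 *.
set B := `|grad_x _ _ _ xh yh| + `|c xh| => projx.
have dt0 : 0 <= dt by rewrite invr_ge0 ltW.
(* The multiplier in [euler_grad dt xh] differs from [yh] by [dt *: c xh], which costs at most
   [M * dt * |c xh| <= |c xh|]. *)
have gxh : `|euler_grad dt xh| <= B.
  have -> : euler_grad dt xh = (euler_grad dt xh - grad_x phi c rho xh yh) +
      grad_x phi c rho xh yh by rewrite subrK.
  apply: le_trans (ler_normD _ _) _; rewrite addrC lerD2l.
  apply: le_trans (grad_x_lipschitz _ _ _ _) _.
  rewrite subrr normr0 addrC addrA addNr add0r (max_r (normr_ge0 _)).
  rewrite normrZ ger0_norm// mulrA ler_piMl// mulrC; lra.
have gx : `|euler_grad dt x| <= M * `|x - xh| + B.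
  have -> : euler_grad dt x =
      (euler_grad dt x - euler_grad dt xh) + euler_grad dt xh.
    by rewrite subrK.
  apply: le_trans (ler_normD _ _) (lerD _ gxh).
  by apply: euler_grad_lipschitz => //; lra.
(* Since [xh] is its own projection, nonexpansiveness gives [|x - xh| <= dt * |euler_grad dt x|].
   The part [dt * M * |x - xh|] is at most half of the left side; absorbing it yields the factor
   2. *)
have xxh : `|x - xh| <= dt * (2 * B).
  have : `|x - xh| <= dt * `|euler_grad dt x|.
    have := metric_projection_nonexpansive C_convex
      (xh - dt *: euler_grad dt x) xh C_closed (ex_intro _ xh Cxh).
    rewrite {1}/euler_grad projx metric_projection_id// addrAC subrr add0r.
    by rewrite normrN normrZ ger0_norm.
  have := ler_wpM2l dt0 gx.
  have := ler_wpM2r (normr_ge0 (x - xh)) lM.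
  by rewrite mulrDr [dt * (M * _)]mulrA [dt * (2 * B)]mulrCA => *; lra.
(* One [B] bounds [|c xh|]; the other bounds [M * |x - xh| <= 2 * (dt * M) * B]. *)
have cx : `|c x| <= 2 * B.
  have -> : c x = (c x - c xh) + c xh by rewrite subrK.
  apply: le_trans (ler_normD _ _) _.
  have := constraint_lipschitz x xh.
  have := ler_wpM2l (ltW M_gt0) xxh.
  have B0 : 0 <= B by rewrite addr_ge0.
  have : M * (dt * (2 * B)) <= B.
    have -> : M * (dt * (2 * B)) = 2 * (dt * M * B) by ring.
    by have := ler_wpM2r B0 lM; lra.
  have : `|c xh| <= B by rewrite lerDr.
  by move=> *; lra.
rewrite prod_normE/= prod_normE/= !ge_max -andbA; apply/and3P; split.
- by rewrite add0r opprK normrZ ger0_norm// ler_wpM2l.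
- by rewrite distrC.
- by rewrite opprD addrA subrr add0r normrN normrZ ger0_norm// ler_wpM2l.
Qed.

End ProjectedEuler.

(** * Choice of a Lipschitz constant and assembly of the theorem *)

Lemma lipschitz_exists (R : realType) (V W : normedModType R) (f : V -> W) :
  lipschitz f -> exists2 M, 0 < M & forall p q, `|f p - f q| <= M * `|p - q|.
Proof.
move=> lipf.
have [M [M0 Mf]] :
    exists M : R, 0 < M /\ M.-lipschitz_on f (globally (setT `*` setT)).
  (* [lipschitz] asserts the bound for all large constants, so a positive one can be picked. *)
  near (pinfty_nbhs R) => M; exists M; split.
    by near: M; exact: nbhs_pinfty_gt.
  by near: M; exact: lipf.
by exists M => // p q; apply: (Mf (p, q)).
Unshelve. all: by end_near. Qed.

Theorem theorem4 (R : realType) (X Y : hilbertType R) (C : set X)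
    (phi : X -> R) (c : X -> Y) (rho : R) (xh : X) (yh : Y)
    (C_neq0 : C !=set0) (C_closed : closed C)
    (C_convex : convex_set (C : set (convex_lmodType X)))
    (phi_C2 : twice_continuously_differentiable phi)
    (c_C2 : twice_continuously_differentiable c)
    (rho_ge0 : 0 <= rho)
    (range_closed : forall x, C x -> c x = 0 -> closed (range ('d c x)))
    (penalized_bounded :
      (-oo < ereal_inf [set (penalized phi c rho x)%:E | x in C])%E)
    (penalized_coercive : forall A : R, exists B : R, forall x : X,
      B <= `|x| -> A <= penalized phi c rho x)
    (c_loc_lipschitz : locally_lipschitz c)
    (L_loc_lipschitz : locally_lipschitz (lagrangian phi c rho))
    (gradL_loc_lipschitz : locally_lipschitz (grad_lagrangian phi c rho))
    (C_xh : C xh) :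
  [/\ forall lambda : R, 0 < lambda ->
        strong_constraint_qualification C (reg_constraint c lambda),
      forall lambda : R, 0 < lambda -> forall (w : Y) (x : X) (y : Y),
        reg_solution C phi c rho xh yh lambda (w, x) y ->
        let dt := 1 / lambda in
        [/\ w = - (dt *: c x),
            x - metric_projection C (xh - dt *: grad_x phi c rho x y) = 0
          & y - yh - dt *: c x = 0],
      lipschitz (grad_lagrangian phi c rho) ->
        (\forall lambda \near +oo, exists! s : Y * X * Y,
          reg_solution C phi c rho xh yh lambda s.1 s.2) /\
        (forall s : R -> Y * X * Y,
          (\forall lambda \near +oo,
            reg_solution C phi c rho xh yh lambda (s lambda).1 (s lambda).2) ->
          s lambda @[lambda --> +oo] --> (0, xh, yh))
    & forall (w : Y) (x : X) (y : Y),
        reg_solution C phi c rho xh yh 0 (w, x) y <->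
        primal_dual_solution inner inner phi C c x y].
Proof.
have phi_diff : forall x, differentiable phi x by case: phi_C2.
have c_diff : forall x, differentiable c x by case: c_C2.
split.
- move=> lambda; apply: reg_strong_constraint_qualification.
  exact: twice_continuously_differentiable_C1.
- move=> lambda l0 w x y /(reg_solution_euler C_closed C_convex phi_diff c_diff l0).
  move=> [Cx wE yE projx] /=; rewrite div1r; split=> //.
    by rewrite projx subrr.
  by rewrite yE [yh + _]addrC addrK subrr.
- move=> /lipschitz_exists[M M0 ML].
  (* All step size conditions hold for large [lambda]; the second one amounts to
     [2 * M <= lambda]. *)
  have small : \forall lambda \near +oo,
      [/\ 0 < lambda, lambda^-1 * M <= 2^-1 & lambda^-1 <= 1].
    near=> lambda; have l0 : 0 < lambda by near: lambda; exact: nbhs_pinfty_gt.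
    split=> //.
      by rewrite ler_pdivrMl// -ler_pdivrMr ?invr_gt0// invrK.
    by rewrite invf_le1//; near: lambda; apply: nbhs_pinfty_ge; rewrite num_real.
  split.
    apply: filterS small => lambda [l0 lM _].
    exact: (reg_solution_unique_existence xh yh C_closed C_convex phi_diff
      c_diff ML M0 C_neq0 l0 lM).
  move=> s s_sol; apply/cvgrPdist_le => e e0; near=> lambda.
  have [l0 lM dt1] : [/\ 0 < lambda, lambda^-1 * M <= 2^-1 & lambda^-1 <= 1].
    by near: lambda.
  have sol : reg_solution C phi c rho xh yh lambda (s lambda).1 (s lambda).2.
    by near: lambda.
  apply: le_trans (reg_solution_dist C_closed C_convex phi_diff c_diff ML M0
    C_xh l0 lM dt1 sol) _.
  (* The distance bound is a constant over [lambda], hence at most [e] once [lambda] reaches that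
     constant divided by [e]. *)
  by rewrite ler_pdivrMl// -ler_pdivrMr.
- by move=> w x y; exact: reg_solution0.
Unshelve. all: by end_near. Qed.
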